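(* Let $s$ and $q$ be positive integers with $s = \frac{q-1}{2}$ and $s \equiv 3 \pmod 4$. If there exists a skew Hadamard matrix of order $s+1$ and there exists a conference matrix of order $q$, then there exists a Hadamard matrix of order $2q(s+1)$.
   Context: A Hadamard matrix of order $n$ is an $n\times n$ matrix $H$ with entries in $\{-1,1\}$ such that $HH^T = H^TH = nI_n$. A skew Hadamard matrix is a Hadamard matrix $H$ of the form $H = S + I$ with $S$ skew-symmetric ($S^T=-S$). Write $J_q$ for the $q\times q$ all-ones matrix. In this paper a conference matrix of order $q$ means a $q\times q$ matrix $C_q$ with zero diagonal, entries $\pm 1$ off the diagonal, satisfying $C_qC_q^T = qI_q - J_q$ and $C_qJ_q = J_qC_q = 0$ (for example, for a prime power $q$, the matrix $C_q=[\chi(\alpha_j-\alpha_i)]_{i,j}$ where $\chi$ is the quadratic character of $GF(q)=\{\alpha_1,\dots,\alpha_q\}$ with $\chi(0)=0$). *)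

(* Defs.v *)
From HB Require Import structures.
From mathcomp Require Export all_boot all_order all_algebra.

Set Implicit Arguments.
Unset Strict Implicit.
Unset Printing Implicit Defensive.

Import GRing.Theory.
Local Open Scope ring_scope.

Definition hadamard (n : nat) (H : 'M[int]_n) : Prop :=
  [/\ forall i j, H i j = -1 \/ H i j = 1,
      H *m H^T = n%:R%:M
    & H^T *m H = n%:R%:M].

Definition skew_symmetric (n : nat) (S : 'M[int]_n) : Prop := S^T = - S.

Definition skew_hadamard (n : nat) (H : 'M[int]_n) : Prop :=
  hadamard H /\ exists2 S : 'M[int]_n, skew_symmetric S & H = S + 1%:M.

Definition all_ones (n : nat) : 'M[int]_n := const_mx 1.

(* This is what is often called the core of a conference matrix of order
   q + 1: the matrix is singular, with C *m C^T = q I - J rather than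
   (q - 1) I. Skew-symmetry is not part of the definition. *)
Definition conference (q : nat) (C : 'M[int]_q) : Prop :=
  [/\ forall i, C i i = 0,
      forall i j, i != j -> C i j = -1 \/ C i j = 1,
      C *m C^T = q%:R%:M - all_ones q,
      C *m all_ones q = 0
    & all_ones q *m C = 0].

(* Main.v *)
Require Import Defs.
From mathcomp Require Import all_boot all_order all_algebra.
From mathcomp Require Import mxtens zify ring.

(** The hypotheses give [q = 3 mod 4], which forces a conference matrix [C] of
    order [q] to be skew.  Bordering [C] by [1]'s and [-1]'s gives a skew matrix
    [W] of order [1 + q] with zero diagonal, other entries [+-1] and
    [W W^T = q I].  Then [I (x) J + W (x) (C + I)] is a Hadamard matrix of order
    [(1 + q) q = 2 q (s + 1)]. *)

Set Implicit Arguments.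
Unset Strict Implicit.
Unset Printing Implicit Defensive.

Import GRing.Theory.

Local Open Scope ring_scope.

Lemma conference_row_sum (q : nat) (C : 'M[int]_q) :
  C *m all_ones q = 0 -> forall i, \sum_k C i k = 0.
Proof.
move=> CJ i; have := congr1 (fun A : 'M__ => A i i) CJ.
by rewrite !mxE => CJi; rewrite -[RHS]CJi; apply: eq_bigr => k _; rewrite mxE mulr1.
Qed.

(* For [i != j] every term of [\sum_(k | k != i, j) (1 + C i k) (1 + C j k)] is
   [0] or [4], while the sum equals [q - 3 - (C i j + C j i)]. *)
Lemma conference_skew (q : nat) (C : 'M[int]_q) :
  (q = 3 %[mod 4])%N -> conference C -> skew_symmetric C.
Proof.
move=> q_mod4 [C0 C1 CCt CJ _]; apply/matrixP => i j; rewrite !mxE.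
have [->|ij] := eqVneq i j; first by rewrite C0 oppr0.
have ji : j != i by rewrite eq_sym.
(* Expanding, the constants give [q], both row sums vanish, and the inner product of two distinct
   rows is an off-diagonal entry of [q I - J], namely [-1]. *)
have sumE : \sum_k (1 + C i k) * (1 + C j k) = q%:R - 1.
  rewrite (eq_bigr (fun k => 1 + C i k + C j k + C i k * C j k)); last first.
    by move=> k _; ring.
  rewrite !big_split /= !conference_row_sum // sumr_const card_ord.
  have := congr1 (fun A : 'M__ => A i j) CCt.
  rewrite !mxE (negPf ij) mulr0n sub0r !addr0 => <-; congr (_ + _).
  by apply: eq_bigr => k _; rewrite mxE.
have /dvdzP[z zE] :
    (4 %| \sum_(k | (k != i) && (k != j)) (1 + C i k) * (1 + C j k))%Z.
  apply: rpred_sum => k /andP[ki kj].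
  have [->|->] : C i k = -1 \/ C i k = 1 by apply: C1; rewrite eq_sym.
    by rewrite addrN mul0r dvdz0.
  have [->|->] // : C j k = -1 \/ C j k = 1 by apply: C1; rewrite eq_sym.
move: sumE; rewrite (bigD1 i) //= (bigD1 j) //= zE !C0.
(* As [q = 3] modulo [4], [C i j + C j i] is a multiple of [4] among [-2], [0], [2], hence zero. *)
by case: (C1 _ _ ij) => ->; case: (C1 _ _ ji) => ->; lia.
Qed.

Definition border (q : nat) (C : 'M[int]_q) : 'M[int]_(1 + q) :=
  block_mx 0 (const_mx 1) (const_mx (- 1)) C.

Lemma border_skew (q : nat) (C : 'M[int]_q) :
  skew_symmetric C -> skew_symmetric (border C).
Proof.
rewrite /skew_symmetric /border tr_block_mx opp_block_mx => ->.
by congr block_mx; apply/matrixP => i j; rewrite !mxE ?oppr0 ?opprK.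
Qed.

Lemma border_sign (q : nat) (C : 'M[int]_q) :
  (forall i j, i != j -> C i j = -1 \/ C i j = 1) ->
  forall i j, i != j -> border C i j = -1 \/ border C i j = 1.
Proof.
move=> C1 i j; rewrite /border.
case: (split_ordP i) => i' ->; case: (split_ordP j) => j' -> ij.
- by move: ij; rewrite !ord1 eqxx.
- by rewrite block_mxEur mxE; right.
- by rewrite block_mxEdl mxE; left.
- by rewrite block_mxEdr; apply: C1; apply: contraNneq ij => ->.
Qed.

(** The mixed blocks of the product are [C] applied to the all-ones column, and its transpose, so
    they vanish. In the lower right block the border column contributes [J], which cancels the [- J]
    of [C *m C^T]. *)
Lemma border_mul_tr (q : nat) (C : 'M[int]_q) :
  conference C -> border C *m (border C)^T = q%:R%:M.
Proof.
move=> [_ _ CCt CJ _].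
have C1 : C *m const_mx 1 = 0 :> 'cV_q.
  apply/matrixP => i j; rewrite !mxE -[RHS](conference_row_sum CJ i).
  by apply: eq_bigr => k _; rewrite mxE mulr1.
rewrite /border tr_block_mx mulmx_block CCt trmx0 !trmx_const !mul0mx !mulmx0.
rewrite !add0r C1 -[const_mx 1 *m C^T]trmxK trmx_mul trmxK trmx_const C1 trmx0.
rewrite scalar_mx_block; congr block_mx.
  apply/matrixP => i j; rewrite !ord1 !mxE eqxx mulr1n.
  under eq_bigr => k _ do rewrite !mxE mulr1.
  by rewrite sumr_const card_ord.
apply/matrixP => i j; rewrite !mxE big_ord1 !mxE; ring.
Qed.

Definition tens_hadamard (m q : nat) (W : 'M[int]_m) (C : 'M[int]_q) :
    'M[int]_(m * q) :=
  1%:M *t all_ones q + W *t (C + 1%:M).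

Lemma tr_tens_hadamard (m q : nat) (W : 'M[int]_m) (C : 'M[int]_q) :
  (tens_hadamard W C)^T = tens_hadamard W^T C^T.
Proof.
rewrite /tens_hadamard linearD /= !trmx_tens linearD /= !tr_scalar_mx.
by rewrite trmx_const.
Qed.

Lemma skew_diag (n : nat) (S : 'M[int]_n) :
  skew_symmetric S -> forall i, S i i = 0.
Proof.
move=> skS i; suff : S i i = - S i i by lia.
by have := congr1 (fun A : 'M__ => A i i) skS; rewrite !mxE.
Qed.

(** Since [W] has zero diagonal, the diagonal blocks are [J] and the others are [C + I] up to sign,
    where [I] fills the zero diagonal of [C]. *)
Lemma tens_hadamard_sign (m q : nat) (W : 'M[int]_m) (C : 'M[int]_q) :
  skew_symmetric W -> skew_symmetric C ->
  (forall i j, i != j -> W i j = -1 \/ W i j = 1) ->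
  (forall i j, i != j -> C i j = -1 \/ C i j = 1) ->
  forall i j, tens_hadamard W C i j = -1 \/ tens_hadamard W C i j = 1.
Proof.
move=> skW skC W1 C1 x y.
case: (mxtens_indexP x) => i j; case: (mxtens_indexP y) => k l.
rewrite mxE !tensmxE !mxE.
have [->|ik] := eqVneq i k; first by rewrite skew_diag // mul0r addr0; right.
have [->|jl] := eqVneq j l.
  by rewrite (skew_diag skC) mul0r !add0r mulr1; apply: W1.
by case: (W1 _ _ ik) => ->; case: (C1 _ _ jl) => ->; [right|left|left|right].
Qed.

(** As [C J = J C^T = 0], the cross terms are [W (x) J] and [W^T (x) J], which cancel. What remains
    is [I (x) q J] plus [q I (x) (C + I) (C + I)^T], and by skewness
    [(C + I) (C + I)^T = (q + 1) I - J]. *)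
Lemma tens_hadamard_mul_tr (m q : nat) (W : 'M[int]_m) (C : 'M[int]_q) :
  skew_symmetric W -> W *m W^T = q%:R%:M ->
  skew_symmetric C -> C *m C^T = q%:R%:M - all_ones q -> C *m all_ones q = 0 ->
  tens_hadamard W C *m (tens_hadamard W C)^T = (q * q.+1)%:R%:M.
Proof.
move=> skW WWt skC CCt CJ.
have JCt : all_ones q *m C^T = 0.
  by rewrite -[LHS]trmxK trmx_mul trmxK trmx_const CJ trmx0.
have JJ : all_ones q *m all_ones q = q%:R *: all_ones q.
  apply/matrixP => i j; rewrite !mxE.
  under eq_bigr => k _ do rewrite !mxE mulr1.
  by rewrite sumr_const card_ord mulr1.
rewrite tr_tens_hadamard /tens_hadamard mulmxDl !mulmxDr !tensmx_mul.
(* The products are evaluated before [skC] and [skW] replace the transposes they mention. *)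
rewrite !mulmxDl !mulmxDr !mulmx1 !mul1mx JJ JCt CJ WWt CCt skC skW.
apply/matrixP => x y.
case: (mxtens_indexP x) => i j; case: (mxtens_indexP y) => k l.
rewrite !mxE !mxtens_indexK /=.
rewrite (can_eq (@mxtens_indexK m q)) xpair_eqE.
by case: (i == k); case: (j == l); rewrite /= ?mulr1n ?mulr0n; ring.
Qed.

Lemma tens_hadamardP (m q : nat) (W : 'M[int]_m) (C : 'M[int]_q) :
  m = q.+1 -> skew_symmetric W -> W *m W^T = q%:R%:M ->
  (forall i j, i != j -> W i j = -1 \/ W i j = 1) ->
  skew_symmetric C -> conference C -> hadamard (tens_hadamard W C).
Proof.
move=> mE skW WWt W1 skC [C0 C1 CCt CJ JC].
split; first exact: tens_hadamard_sign.
  by rewrite tens_hadamard_mul_tr // mE mulnC.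
(* The transpose is the same construction on [W^T = - W] and [C^T = - C], which satisfy the same
   identities, so the other product is an instance of the first. *)
rewrite -[X in _ *m X]trmxK tr_tens_hadamard tens_hadamard_mul_tr ?mE 1?mulnC //.
- by rewrite /skew_symmetric skW linearN /= skW.
- by rewrite -WWt trmxK skW mulNmx mulmxN.
- by rewrite /skew_symmetric skC linearN /= skC.
- by rewrite -CCt trmxK skC mulNmx mulmxN.
- by rewrite skC mulNmx CJ oppr0.
Qed.

Theorem hadamard_of_conference (q : nat) (C : 'M[int]_q) :
  (q = 3 %[mod 4])%N -> conference C ->
  hadamard (tens_hadamard (border C) C).
Proof.
move=> q_mod4 confC; have skC := conference_skew q_mod4 confC.
apply: tens_hadamardP => //; first exact: border_skew.
  exact: border_mul_tr.
by case: confC => _ C1 _ _ _; apply: border_sign.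
Qed.

Theorem theorem3p2 (s q : nat) (s_gt0 : (0 < s)%N) (q_gt0 : (0 < q)%N)
    (sE : s%:R = (q%:R - 1) / 2%:R :> rat) (s_mod4 : (s = 3 %[mod 4])%N)
    (skewH : exists H : 'M[int]_(s + 1), skew_hadamard H)
    (confC : exists C : 'M[int]_q, conference C) :
  exists H : 'M[int]_(2 * q * (s + 1)), hadamard H.
Proof.
have qE : q = (2 * s + 1)%N.
  apply/eqP; rewrite -(Num.Theory.eqr_nat rat) natrD natrM sE; apply/eqP.
  by field.
case: confC => C confC.
rewrite (_ : (2 * q * (s + 1) = (1 + q) * q)%N); last by rewrite qE; ring.
exists (tens_hadamard (border C) C); apply: hadamard_of_conference => //.
by rewrite qE; lia.
Qed.
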